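(* If $\mathfrak{X}$ is infinite then the center of $\mathcal{M}$ is zero.
   Context: $\mathfrak{X}$ is a fixed compact metrizable space and $\mathfrak{m}$ is a fixed Borel probability measure on $\mathfrak{X}$ whose support is all of $\mathfrak{X}$. $\mathcal{M}=\mathcal{M}_{\mathfrak{X},\mathfrak{m}}$ denotes the Banach $*$-algebra $\mathbf{C}(\mathfrak{X}^2)$ of continuous complex functions on $\mathfrak{X}\times\mathfrak{X}$ with the supremum norm, the multiplication $(f\star g)(x,y)=\int_{\mathfrak{X}}f(x,z)g(z,y)\,d\mathfrak{m}(z)$ and the involution $f^*(x,y)=\overline{f(y,x)}$. *)

(* Defs.v *)
From HB Require Import structures.
From mathcomp Require Import all_boot all_order all_algebra.
From mathcomp Require Import all_classical all_reals all_analysis measurable_realfun.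
From mathcomp Require Export complex.

Set Implicit Arguments.
Unset Strict Implicit.
Unset Printing Implicit Defensive.

Import Order.TTheory GRing.Theory Num.Theory.
Import numFieldNormedType.Exports.

Local Open Scope classical_set_scope.
Local Open Scope ring_scope.
Local Open Scope complex_scope.

Definition metrizable (R : realType) (X : topologicalType) : Prop :=
  exists d : X -> X -> R,
    [/\ forall x y, d x y = 0 <-> x = y,
        forall x y, d x y = d y x,
        forall x y z, d x z <= d x y + d y z &
        forall x, nbhs x =
          filter_from [set e : R | 0 < e] (fun e => [set y | d x y < e])].

Notation borel X := (g_sigma_algebraType (@open X)).

Section convolution_algebra.
Context (R : realType) (X : ptopologicalType).
Variable m : {measure set (borel X) -> \bar R}.

(* Open sets are used here because an arbitrary neighborhood need not be
   Borel. *)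
Definition msupport : set X :=
  [set x | forall U : set X, open U -> U x -> (0 < m U)%E].

Definition Cintegral (F : X -> R[i]) : R[i] :=
  (\int[m]_z complex.Re (F z)) +i* (\int[m]_z complex.Im (F z)).

Definition conv_mul (f g : X * X -> R[i]) (p : X * X) : R[i] :=
  Cintegral (fun z => f (p.1, z) * g (z, p.2)).

(* R[i]^o is R[i] with the topology of the modulus. *)
Definition CX2 : set (X * X -> R[i]) :=
  [set f | continuous (f : X * X -> R[i]^o)].

Definition conv_center : set (X * X -> R[i]) :=
  [set f | CX2 f /\ forall g, CX2 g -> conv_mul f g = conv_mul g f].

End convolution_algebra.

Section conv_mul_closed.
Context (R : realType) (X : ptopologicalType).
Hypothesis Xc : compact [set: X].

Let ReIm (b : bool) (z : R[i]) : R := if b then complex.Re z else complex.Im z.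

Let ReImB b z w : ReIm b (z - w) = ReIm b z - ReIm b w.
Proof. by case: b z w => -[a c] [a' c']. Qed.

Let ReIm_le b (z : R[i]) : (`|ReIm b z|)%:C <= `|z|.
Proof.
case: z => a c; rewrite normc_def lecR; case: b => /=.
  by rewrite -sqrtr_sqr ler_wsqrtr// lerDl sqr_ge0.
by rewrite -sqrtr_sqr ler_wsqrtr// lerDr sqr_ge0.
Qed.

Let norm_le_ReIm (z : R[i]) :
  `|z| <= (`|ReIm true z| + `|ReIm false z|)%:C.
Proof.
case: z => a c; rewrite normc_def lecR /=.
rewrite -[leRHS]ger0_norm ?addr_ge0// -sqrtr_sqr ler_wsqrtr// sqrrD.
by rewrite !real_normK ?num_real// addrAC lerDl mulrn_wge0// mulr_ge0.
Qed.

Let ReIm_continuous b : continuous (ReIm b : R[i]^o -> R).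
Proof.
move=> z; apply/(@cvgrPdist_lt _ _ _ _ (nbhs_filter (z : R[i]^o))) => e e0.
apply/(@nbhs_ballP R[i] R[i]^o); exists e%:C; first by rewrite /= ltcR.
move=> w; rewrite /ball/= => zw.
by rewrite -ReImB -ltcR; apply: le_lt_trans zw; exact: ReIm_le.
Qed.

Let continuous_measurable (F : X -> R) : continuous F ->
  measurable_fun [set: borel X] (F : borel X -> R).
Proof.
move=> cF; apply: (measurability _ (RGenOpens.measurableE R)) => //.
move=> _ [_ [a [b ->]] <-].
rewrite setTI; apply: sub_sigma_algebra.
by apply: open_comp => [x _|]; [exact: cF|exact: interval_open].
Qed.

Variable m : {finite_measure set (borel X) -> \bar R}.

Lemma continuous_integrable (F : X -> R) : continuous F ->
  m.-integrable [set: borel X] (EFin \o (F : borel X -> R)).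
Proof.
move=> cF; apply: measurable_bounded_integrable => //.
- exact: fin_num_fun_lty.
- exact: continuous_measurable.
- have /compact_bounded[M [_ mrt]] :=
    continuous_compact (continuous_subspaceT cF) Xc.
  by exists M; split; rewrite ?num_real // => y My x _; apply: mrt => //; exists x.
Qed.

Let continuous_kernel (K : numFieldType) (f g : X * X -> K) :
  continuous f -> continuous g ->
  continuous (fun w : X * (X * X) => f (w.2.1, w.1) * g (w.1, w.2.2)).
Proof.
move=> cf cg w; apply: cvgM.
  apply: (@continuous_comp _ _ _ (fun w : X * (X * X) => (w.2.1, w.1)) f).
    apply: cvg_pair => /=; last exact: cvg_fst.
    by apply: (@continuous_comp _ _ _ snd fst); [exact: cvg_snd|exact: cvg_fst].
  exact: cf.
apply: (@continuous_comp _ _ _ (fun w : X * (X * X) => (w.1, w.2.2)) g).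
  apply: cvg_pair => /=; first exact: cvg_fst.
  by apply: (@continuous_comp _ _ _ snd snd); [exact: cvg_snd|exact: cvg_snd].
exact: cg.
Qed.

Let continuous_Rintegral (h : X * (X * X) -> R) : continuous h ->
  continuous (fun p : X * X => \int[m]_z h (z, p)).
Proof.
move=> ch p; apply/cvgrPdist_lt => e e0.
have ch1 q : continuous (fun z => h (z, q)).
  move=> z; apply: (@continuous_comp _ _ _ (fun z => (z, q)) h); last exact: ch.
  exact: (cvg_pair cvg_id (cvg_cst q)).
have mT0 : 0 <= fine (m setT) by exact: fine_ge0.
pose d := e / (fine (m setT) + 1).
have d0 : 0 < d by rewrite divr_gt0// ltr_wpDl.
have : \forall q \near p, [set: X] `<=` (fun z => `|h (z, p) - h (z, q)| < d).
  have /compact_near_coveringP ncX := Xc.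
  apply: (ncX _ (nbhs p) (fun q z => `|h (z, p) - h (z, q)| < d)) => z _.
  have hz : \forall w \near (z, p), `|h (z, p) - h w| < d / 2.
    by move/cvgrPdist_lt : (ch (z, p)); apply; rewrite divr_gt0.
  case: hz => -[A B] [/= Az Bp] AB.
  exists (A, B) => // -[z' q] /= [Az' Bq].
  have h1 := AB (z', q) (conj Az' Bq).
  have h2 := AB (z', p) (conj Az' (nbhs_singleton Bp)).
  rewrite [d]splitr (le_lt_trans (ler_distD (h (z, p)) _ _))//.
  by rewrite ltrD// distrC.
apply: filterS => q hq.
rewrite -RintegralB//; [|exact: continuous_integrable..].
have cB : continuous (fun z => h (z, p) - h (z, q)).
  by move=> z; apply: cvgB; exact: ch1.
apply: (le_lt_trans (le_normr_Rintegral _ _)) => //.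
  exact: continuous_integrable.
apply: (@le_lt_trans _ _ (\int[m]_(z in [set: borel X]) d)).
  apply: le_Rintegral => //.
  - by apply: (@continuous_integrable (fun z => `|h (z, p) - h (z, q)|)) => z;
      apply: cvg_norm; exact: cB.
  - by apply: (@continuous_integrable (fun=> d)) => z; exact: cvg_cst.
  - by move=> z _; apply/ltW/hq.
rewrite Rintegral_cst// /d mulrAC ltr_pdivrMr ?ltr_wpDl//.
by rewrite ltr_pM2l// ltrDl.
Qed.

(* Well-definedness of the product: the integrands in conv_mul are integrable and
   C(X^2) is stable under conv_mul. *)
Lemma conv_mul_continuous (f g : X * X -> R[i]) :
  CX2 f -> CX2 g -> CX2 (conv_mul m f g).
Proof.
move=> cf cg.
have ck b : continuous (fun w : X * (X * X) =>
    ReIm b (f (w.2.1, w.1) * g (w.1, w.2.2))).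
  move=> w; apply: (@continuous_comp _ R[i]^o _ (fun w : X * (X * X) =>
    f (w.2.1, w.1) * g (w.1, w.2.2)) (ReIm b)); last exact: ReIm_continuous.
  exact: (@continuous_kernel R[i] f g cf cg).
have cs b := continuous_Rintegral (ck b).
move=> p; apply/(@cvgrPdist_lt _ _ _ _ (nbhs_filter (p : X * X))) => -[e e'].
rewrite ltcE/= => /andP[/eqP-> e0].
have e2 : 0 < e / 2 by rewrite divr_gt0.
have /cvgrPdist_lt /(_ _ e2) near_re := cs true p.
have /cvgrPdist_lt /(_ _ e2) near_im := cs false p.
near=> q.
rewrite (le_lt_trans (norm_le_ReIm _))// !ReImB ltcR [e]splitr ltrD//.
  by near: q; exact: near_re.
by near: q; exact: near_im.
Unshelve. all: by end_near. Qed.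

End conv_mul_closed.

(* Main.v *)
Require Import Defs.
From HB Require Import structures.
From mathcomp Require Import all_boot all_order all_algebra.
From mathcomp Require Import all_classical all_reals all_analysis.
From mathcomp Require Import complex.
From mathcomp Require Import measurable_realfun ring lra.

Import Order.TTheory GRing.Theory Num.Theory.
Import numFieldNormedType.Exports.

Local Open Scope classical_set_scope.
Local Open Scope ring_scope.

(* Let f be central and let d metrize X. Testing f against the kernel
   g(z, y) = conj(f(x, z)) d(x, z), the product f * g at (x, x) is the integral
   of |f(x, z)|^2 d(x, z), whereas g * f vanishes there because d(x, x) = 0; as
   the measure has full support, f vanishes off the diagonal. An infinite
   compact X has a non-isolated point p, so f(p, p) = 0 by continuity and
   f(-, p) = 0. Testing against g(z, y) = conj(f(x, z)) at (x, p), the integral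
   of |f(x, z)|^2 equals that of conj(f(x, x)) f(z, p) = 0, so f(x, -) = 0. *)

Lemma Re_continuous (R : realType) : continuous (@complex.Re R : R[i]^o -> R).
Proof.
move=> z; apply/(@cvgrPdist_lt _ _ _ _ (nbhs_filter (z : R[i]^o))) => e e0.
apply/(@nbhs_ballP R[i] R[i]^o); exists e%:C%C; first by rewrite /= ltcR.
move=> w; rewrite /ball/= => zw.
by rewrite -raddfB -ltcR; apply: le_lt_trans zw; exact: normc_ge_Re.
Qed.

Lemma conjc_continuous (R : realType) :
  continuous (@conjc R : R[i]^o -> R[i]^o).
Proof.
move=> z; apply/(@cvgrPdist_lt _ _ _ _ (nbhs_filter (z : R[i]^o))) => e e0.
apply/(@nbhs_ballP R[i] R[i]^o); exists e => // w; rewrite /ball/= => zw.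
by rewrite -raddfB normcJ.
Qed.

Lemma real_complex_continuous (R : realType) :
  continuous (@real_complex R : R -> R[i]^o).
Proof.
move=> x; apply/(@cvgrPdist_lt _ R[i]^o _ _ (nbhs_filter x)) => -[e e'].
(* A positive element of [R[i]] has zero imaginary part, so the radius is a real number. *)
rewrite ltcE/= => /andP[/eqP-> e0].
have /cvgrPdist_lt /(_ _ e0) := @cvg_id _ (nbhs x).
apply: filterS => y xy.
by rewrite -raddfB normc_def /= expr0n /= addr0 sqrtr_sqr ltcR.
Qed.

(** Otherwise the singletons form an open cover, and a finite subcover makes [T] finite. *)
Lemma compact_infinite_nonisolated (T : ptopologicalType) :
  compact [set: T] -> infinite_set [set: T] -> exists p : T, ~ open [set p].
Proof.
rewrite compact_cover => cT infT; apply: contrapT => /forallNP/= op.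
have [||D _ TD] := cT T setT (fun x => [set x]).
- by move=> x _; apply: contrapT; exact: op.
- by move=> x _; exists x.
apply: infT; apply: (sub_finite_set _ (finite_fset D)).
by move=> x /TD[y /= yD ->].
Qed.

(** If [h x > 0], the open set where [h] exceeds [h x / 2] has positive measure by full support, but
    measure zero by Markov's inequality. *)
Lemma Rintegral_full_support_eq0 (R : realType) (X : ptopologicalType)
    (m : {finite_measure set (borel X) -> \bar R}) (h : X -> R) :
  compact [set: X] -> msupport m = [set: X] -> continuous h ->
  (forall x, 0 <= h x) -> \int[m]_x h x = 0 -> forall x, h x = 0.
Proof.
move=> cX suppm ch h0 Ih0 x; apply/eqP; rewrite eq_le h0 andbT leNgt.
apply/negP => hx0.
have ih := continuous_integrable cX m ch.
(* The real integral is the [fine] part of the extended one, and [fine] also sends infinities to 0;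
   integrability excludes that case. *)
have {}Ih0 : (\int[m]_z (h z)%:E = 0)%E.
  by rewrite -[LHS]fineK; [congr EFin|exact: integrable_fin_num].
have a0 : 0 < h x / 2 by rewrite divr_gt0.
pose U := [set y | h x / 2 < h y].
have oU : open U.
  by apply: (@open_comp X R h [set r | h x / 2 < r]) => [y _|];
    [exact: ch|exact: open_gt].
have Ux : U x by rewrite /U/= ltr_pdivrMr// ltr_pMr// ltr1n.
have : msupport m x by rewrite suppm.
move=> /(_ U oU Ux); apply/negP; rewrite -leNgt.
have mh := measurable_int _ ih.
have := le_integral_abse m measurableT mh a0.
under eq_integral do rewrite /= ger0_norm//.
rewrite Ih0 pmule_rle0 ?lte_fin// => Uh.
apply: le_trans Uh; apply: le_measure; rewrite ?inE.
- exact: sub_sigma_algebra.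
- by apply: emeasurable_fun_c_infty => //; exact: measurableT_comp.
- by move=> y Uy; split => //=; rewrite lee_fin ger0_norm// ltW.
Qed.

Lemma CX2_section (R : realType) (X : ptopologicalType) (f : X * X -> R[i]) x :
  CX2 f -> continuous (fun z => f (x, z) : R[i]^o).
Proof.
move=> cf z; apply: (@continuous_comp _ _ _ (fun z => (x, z)) (f : _ -> R[i]^o)).
  exact: (cvg_pair (cvg_cst x) cvg_id).
exact: cf.
Qed.

(** The integrand of the product at [(x, y)] is [|f (x, z)|^2 * w z], continuous and nonnegative, so
    a zero integral makes it vanish pointwise. The weight [w] covers both tests of centrality: the
    distance to [x], then the constant 1. *)
Lemma conv_mul_conj_eq0 (R : realType) (X : ptopologicalType)
    (m : {finite_measure set (borel X) -> \bar R})
    (f : X * X -> R[i]) (w : X -> R) (x y : X)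
    (g := fun p : X * X => (f (x, p.1))^*%C * (w p.1)%:C%C) :
  compact [set: X] -> msupport m = [set: X] -> CX2 f -> continuous w ->
  (forall z, 0 <= w z) ->
  CX2 g /\ (conv_mul m f g (x, y) = 0 -> forall z, w z != 0 -> f (x, z) = 0).
Proof.
move=> cX suppm cf cw w0; have cfx := CX2_section _ _ _ x cf.
have cg1 : continuous (fun z => (f (x, z))^*%C * (w z)%:C%C : R[i]^o).
  move=> z; apply: (@cvgM R[i]^o).
    apply: (@continuous_comp _ R[i]^o R[i]^o _ (@conjc R)); first exact: cfx.
    exact: conjc_continuous.
  apply: (@continuous_comp _ R R[i]^o w (real_complex R)); first exact: cw.
  exact: real_complex_continuous.
split.
  move=> p; apply: (@continuous_comp _ _ R[i]^o (@fst X X)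
    (fun z => (f (x, z))^*%C * (w z)%:C%C)); first exact: cvg_fst.
  exact: cg1.
rewrite /conv_mul /Cintegral => -[+ _] z wz => /Rintegral_full_support_eq0.
have Ereal u : complex.Re (f (x, u) * g (u, y)) =
    (complex.Re (f (x, u)) ^+ 2 + complex.Im (f (x, u)) ^+ 2) * w u.
  by rewrite /g/=; case: (f (x, u)) => a b /=; ring.
move=> /(_ cX suppm _ _ z)/=; rewrite Ereal => H.
have : (complex.Re (f (x, z)) ^+ 2 + complex.Im (f (x, z)) ^+ 2) * w z = 0.
  apply: H.
    move=> u; apply: (@continuous_comp _ R[i]^o R
      (fun v => f (x, v) * g (v, y)) (@complex.Re R)); last exact: Re_continuous.
    by apply: (@cvgM R[i]^o); [exact: cfx|exact: cg1].
  by move=> u; rewrite Ereal mulr_ge0// addr_ge0// sqr_ge0.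
move/eqP; rewrite mulf_eq0 (negbTE wz) orbF paddr_eq0 ?sqr_ge0// !sqrf_eq0.
by case: (f (x, z)) => a b /= /andP[/eqP-> /eqP->].
Qed.

Theorem theorem4p1 (R : realType) (X : ptopologicalType)
    (m : probability (borel X) R) :
  compact [set: X] -> metrizable R X -> msupport m = [set: X] ->
  infinite_set [set: X] ->
  conv_center m = [set cst 0].
Proof.
move=> cX [d [d0 dC dT nbhsd]] suppm infX; apply/seteqP; split; last first.
  move=> _ ->; split; first by move=> p; exact: (@cvg_cst R[i]^o).
  move=> g _; apply/funext => p; rewrite /conv_mul/=; congr Cintegral.
  by apply/funext => z; rewrite mul0r mulr0.
move=> f [cf fC].
have Cint0 : Cintegral m (cst 0 : X -> R[i]) = 0.
  by rewrite /Cintegral Rintegral_cst// mul0r.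
(* Nonnegativity follows from the triangle inequality and symmetry: [0 = d x x <= 2 * d x y]. *)
have dge0 x y : 0 <= d x y.
  have := dT x y x; rewrite (d0 x x).2// (dC y x) -mulr2n.
  by rewrite pmulrn_lge0.
have cd x : continuous (d x).
  move=> z; apply/cvgrPdist_lt => e e0.
  have : nbhs z [set y | d z y < e] by rewrite nbhsd; exists e.
  apply: filterS => y /= zy.
  apply: le_lt_trans zy; rewrite ler_norml.
  by have := dT x z y; have := dT x y z; rewrite (dC y z); lra.
have f_off x z : x <> z -> f (x, z) = 0.
  move=> xz.
  have [cg] := conv_mul_conj_eq0 R X m f (d x) x x cX suppm cf (cd x) (dge0 x).
  apply; last by apply/eqP => /d0.
  rewrite fC// -[RHS]Cint0 /conv_mul/=; congr Cintegral.
  by apply/funext => u; rewrite (d0 x x).2// mulr0 mul0r.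
have [p np] := compact_infinite_nonisolated X cX infX.
have fpp : f (p, p) = 0.
  apply: contrapT => /eqP fp0; apply: np.
  (* Continuity is applied with radius [|f (p, p)|]: any [z <> p] has [f (p, z) = 0], hence lies at
     exactly that distance, so the neighborhood obtained is contained in [[set p]]. *)
  have := CX2_section _ _ _ p cf p.
  move=> /(@cvgrPdist_lt _ R[i]^o _ _ (nbhs_filter p)) /(_ `|f (p, p)|).
  rewrite normr_gt0 => /(_ fp0) fnear.
  rewrite openE => _ ->; apply: filterS fnear => z /=.
  by apply: contraPP => zp; rewrite (f_off p z) ?subr0 ?ltxx// => /esym.
have fp z : f (z, p) = 0.
  by have [->//|/eqP] := eqVneq z p; exact: f_off.
apply/funext => -[x z].
(* Unlike [d x], the weight 1 vanishes nowhere, so the case [z = x] is included. *)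
have [||cg] := conv_mul_conj_eq0 R X m f (cst 1) x p cX suppm cf.
- by move=> u; exact: cvg_cst.
- by move=> u; rewrite ler01.
apply; last by rewrite oner_neq0.
rewrite fC// -[RHS]Cint0 /conv_mul/=; congr Cintegral.
by apply/funext => u; rewrite fp mulr0.
Qed.
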